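(* There is an absolute constant $C$ such that for all $\delta,D\ge 1$ there exist parameters $\gamma^*\ge2$, $\eta^*>0$ and $\beta^*>1$ (depending only on $\delta,D$) for which the $\gamma$GR-BAL algorithm run with $(\gamma,\eta,\beta)=(\gamma^*,\eta^*,\beta^* )$ is a feasible online policy on all instances (with real-valued durations) satisfying the locally bounded reward assumption with parameters $\delta,D$, and is asymptotically $\Gamma(\delta,D)$-competitive as $c_{\min}:=\min_i c_i\to\infty$, where $$\Gamma(\delta,D)=\ln(\delta D)+2\ln\ln(\delta\vee D)+C\quad\text{if }\ln(\delta\vee D)\ge e-1,\qquad \Gamma(\delta,D)=C\quad\text{otherwise.}$$
   Context: Notation: $[k]=\{1,\dots,k\}$, $[0]=\emptyset$, $a\vee b=\max(a,b)$, $a\wedge b=\min(a,b)$. Model. There are $n$ servers $[n]$; server $i$ has integer capacity $c_i\ge1$. Jobs $1,\dots,m$ are revealed one at a time in index order, with real arrival times $0\le t_1\le\dots\le t_m$ (jobs with equal arrival times are still revealed one after another). $E\subseteq[n]\times[m]$ is the set of compatible pairs and $\mathcal N(j)=\{i:(i,j)\in E\}$. Each $(i,j)\in E$ has a reward rate $r_{ij}>0$ and a duration $d_{ij}>0$. When job $j$ is revealed (with $t_j$, $\mathcal N(j)$ and $(r_{ij},d_{ij})_{i\in\mathcal N(j)}$), the algorithm must irrevocably assign it to one server in $\mathcal N(j)$ or reject it, without knowledge of later jobs. A job $j$ assigned to $i$ occupies one unit of capacity of $i$ during $[t_j,t_j+d_{ij})$ and yields reward $r_{ij}d_{ij}$.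 A policy is feasible if for every server $i$ and time $t\ge0$ the number of jobs $j$ assigned to $i$ with $t_j\le t<t_j+d_{ij}$ is at most $c_i$. $\mathrm{ALG}(I)$ is the total reward collected by the algorithm on instance $I$; $\mathrm{OPT}(I)$ is the maximum total reward of a feasible (integral) assignment computed with full knowledge of $I$. Locally bounded reward assumption (parameters $\delta,D\ge1$, known to the algorithm): $1\le d_{ij}\le D$ for all $(i,j)\in E$; and $1/\delta\le r_{ij}/r_{ij'}\le\delta$ whenever $i\in\mathcal N(j)\cap\mathcal N(j')$ and $|t_j-t_{j'}|\le D$. $\mathcal I(\delta,D,\{c_i\})$ is the set of all finite instances satisfying it with server capacities $\{c_i\}_{i\in[n]}$. An online algorithm is asymptotically $\Gamma$-competitive if $\limsup_{\min_i c_i\to\infty}\ \sup_{I\in\mathcal I(\delta,D,\{c_i\})}\mathrm{OPT}(I)/\mathbb E[\mathrm{ALG}(I)]\le\Gamma$ (instances with $\mathrm{OPT}(I)=0$ are disregarded). BALANCE framework. Given losses $\mathcal L_{ij}$, when job $j$ arrives: if $\max_{i\in\mathcal N(j)}\{r_{ij}d_{ij}-\mathcal L_{ij}\}>0$, assign $j$ to a server attaining this maximum; otherwise leave $j$ unassigned. $\gamma$GR-BAL. Let $\Psi(x)=\eta(\beta^{1-x}-1)$ with $\eta>0,\beta>1$, and let $\gamma$ be a real parameter. For $T_1<T_2$ let $\mathcal T_\gamma[T_1,T_2)=\{T_1+l/\gamma:\ l\in\mathbb Z_{\ge0},\ T_1+l/\gamma<T_2\}$. For $(i,j)\in E$ and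 $t\ge t_j$, let $\tilde{\boldsymbol r}_{i,j,t}$ be the multiset of reward rates $r_{ih}$ of the jobs $h<j$ that were assigned to $i$ and remain active at time $t$ (i.e. $t<t_h+d_{ih}$); $|\tilde{\boldsymbol r}_{i,j,t}|$ is its cardinality, $\tilde r^{(\ell)}_{i,j,t}$ its $\ell$-th largest element, and $\tilde r^{(0)}_{i,j,t}=+\infty$. $\gamma$GR-BAL is the BALANCE framework with $$\mathcal L_{ij}=\mathcal L^{\mathrm{GR},\gamma}_{ij}=\sum_{\tau\in\mathcal T_\gamma[t_j,t_j+d_{ij})}\ \max_{\ell\in\{0\}\cup[|\tilde{\boldsymbol r}_{i,j,\tau}|]}\bigl(\tilde r^{(\ell)}_{i,j,\tau}\wedge r_{ij}\bigr)\Psi(1-\ell/c_i).$$ *)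

(* Defs.v *)
From HB Require Import structures.
From mathcomp Require Import all_boot all_order all_algebra.
From mathcomp Require Import all_classical all_reals all_analysis.

Set Implicit Arguments.
Unset Strict Implicit.
Unset Printing Implicit Defensive.

Import Order.TTheory GRing.Theory Num.Theory.
Local Open Scope classical_set_scope.
Local Open Scope ring_scope.

Record servers := Servers {
  nserv : nat;
  cap : 'I_nserv -> nat;
  cap_ge1 : forall i, (1 <= cap i)%N }.

(* What is revealed with a job; [rate i] and [dur i] are meaningful only for
   [i \in nbr]. *)
Record job (R : realType) (n : nat) := Job {
  arr : R;
  nbr : {set 'I_n};
  rate : 'I_n -> R;
  dur : 'I_n -> R }.

HB.instance Definition _ (R : realType) (n : nat) := gen_eqMixin (job R n).

(* Jobs in order of revelation, each with the decision taken for it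
   ([None] means that the job is rejected). *)
Definition history (R : realType) (n : nat) := seq (job R n * option 'I_n).

Definition instance (R : realType) (n : nat) (I : seq (job R n)) : Prop :=
  [/\ sorted <=%R [seq arr j | j <- I],
      (forall j, j \in I -> 0 <= arr j) &
      (forall j i, j \in I -> i \in nbr j -> 0 < rate j i /\ 0 < dur j i)].

Definition locally_bounded (R : realType) (delta D : R) (n : nat)
    (I : seq (job R n)) : Prop :=
  (forall j i, j \in I -> i \in nbr j -> 1 <= dur j i <= D) /\
  (forall j j' i, j \in I -> j' \in I -> i \in nbr j -> i \in nbr j' ->
     `|arr j - arr j'| <= D -> delta^-1 <= rate j i / rate j' i <= delta).

Definition unfinished (R : realType) (n : nat) (i : 'I_n) (t : R)
    (ja : job R n * option 'I_n) : bool :=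
  (ja.2 == Some i) && (t < arr ja.1 + dur ja.1 i).

Definition feasible (R : realType) (S : servers) (H : history R (nserv S)) :
    Prop :=
  (forall j i, (j, Some i) \in H -> i \in nbr j) /\
  (forall (i : 'I_(nserv S)) (t : R), 0 <= t ->
     (count (fun ja => (arr ja.1 <= t)%R && unfinished i t ja) H <= cap i)%N).

Definition reward (R : realType) (n : nat) (H : history R n) : R :=
  \sum_(ja <- H) (if ja.2 is Some i then rate ja.1 i * dur ja.1 i else 0).

(* The seed 0 of the maximum is the reward of the empty assignment. *)
Definition OPT (R : realType) (S : servers) (I : seq (job R (nserv S))) : R :=
  \big[Num.max/0]_(a : (size I).-tuple (option 'I_(nserv S))
                   | `[< feasible (zip I a) >]) reward (zip I a).

(* The decision for a job depends on the servers and their capacities, the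
   jobs revealed earlier with the decisions taken for them, and the job
   itself. *)
Definition algorithm (R : realType) :=
  forall S : servers,
    history R (nserv S) -> job R (nserv S) -> option 'I_(nserv S).

Definition run (R : realType) (A : algorithm R) (S : servers)
    (I : seq (job R (nserv S))) : history R (nserv S) :=
  foldl (fun H j => rcons H (j, A S H j)) [::] I.

Definition ALG (R : realType) (A : algorithm R) (S : servers)
    (I : seq (job R (nserv S))) : R := reward (run A I).

Definition feasible_policy (R : realType) (delta D : R) (A : algorithm R) :
    Prop :=
  forall (S : servers) (I : seq (job R (nserv S))),
    instance I -> locally_bounded delta D I -> feasible (run A I).

(* The quotient is taken in the extended reals, where [x / 0 = +oo] for
   [0 < x]. *)
Definition worst_ratio (R : realType) (delta D : R) (A : algorithm R)
    (S : servers) : \bar R :=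
  ereal_sup [set ((OPT I)%:E / (ALG A I)%:E)%E | I in
    [set I : seq (job R (nserv S)) |
      [/\ instance I, locally_bounded delta D I & OPT I != 0]]].

(* The filter "min_i c_i --> oo" on capacity profiles with any number of
   servers. *)
Definition cmin_oo : set_system servers :=
  filter_from [set: nat] (fun K => [set S | forall i, (K <= @cap S i)%N]).

(* The limit superior is written out because [limf_esup] requires its domain to
   be a [filteredType]. *)
Definition asymptotically_competitive (R : realType) (delta D : R)
    (A : algorithm R) (Gam : R) : Prop :=
  (ereal_inf [set ereal_sup (worst_ratio delta D A @` V) | V in cmin_oo]
   <= Gam%:E)%E.

(* [o] is a possible decision of BALANCE for the compatible servers [N] and the
   pseudo-rewards [v i = r_ij d_ij - L_ij]; ties are broken arbitrarily. *)
Definition balance_choice (R : realType) (n : nat) (N : {set 'I_n})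
    (v : 'I_n -> R) (o : option 'I_n) : Prop :=
  if o is Some i then
    [/\ i \in N, 0 < v i & forall k, k \in N -> v k <= v i]
  else forall k, k \in N -> v k <= 0.

Definition Psi (R : realType) (eta beta x : R) : R :=
  eta * (beta `^ (1 - x) - 1).

(* T_gamma[T1, T2), for [0 < gamma]: [T1 + l / gamma < T2] forces
   [l <= truncn (gamma * (T2 - T1))]. *)
Definition grid (R : realType) (gamma T1 T2 : R) : seq R :=
  [seq tau <- [seq T1 + l%:R / gamma
              | l <- iota 0 (Num.truncn (gamma * (T2 - T1))).+1] | tau < T2].

(* The multiset of rates of the jobs of [H] assigned to [i] and active at
   [tau], in nonincreasing order. *)
Definition active_rates (R : realType) (n : nat) (H : history R n) (i : 'I_n)
    (tau : R) : seq R :=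
  sort >=%R [seq rate ja.1 i | ja <- H & unfinished i tau ja].

(* r^(l) /\ r, where r^(l) is the [l]-th largest element of the nonincreasing
   [rs] and r^(0) = +oo. *)
Definition capped_rate (R : realType) (rs : seq R) (l : nat) (r : R) : R :=
  if l is k.+1 then Num.min (nth 0 rs k) r else r.

(* The seed of the maximum is its term at [l = 0]. *)
Definition GR_price (R : realType) (eta beta : R) (c : nat) (rs : seq R)
    (r : R) : R :=
  let term l := capped_rate rs l r * Psi eta beta (1 - l%:R / c%:R) in
  \big[Num.max/term 0%N]_(l < (size rs).+1) term l.

Definition GR_loss (R : realType) (gamma eta beta : R) (S : servers)
    (H : history R (nserv S)) (j : job R (nserv S)) (i : 'I_(nserv S)) : R :=
  \sum_(tau <- grid gamma (arr j) (arr j + dur j i))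
     GR_price eta beta (cap i) (active_rates H i tau) (rate j i).

Definition is_GR_BAL (R : realType) (gamma eta beta : R) (A : algorithm R) :
    Prop :=
  forall (S : servers) (H : history R (nserv S)) (j : job R (nserv S)),
    balance_choice (nbr j)
      (fun i => rate j i * dur j i - GR_loss gamma eta beta H j i) (A S H j).

Lemma GR_BAL_exists (R : realType) (gamma eta beta : R) :
  exists A : algorithm R, is_GR_BAL gamma eta beta A.
Proof.
suff choice_ex n (N : {set 'I_n}) (v : 'I_n -> R) :
    exists o, balance_choice N v o.
  exists (fun S H j => projT1 (cid (choice_ex _ (nbr j)
    (fun i => rate j i * dur j i - GR_loss gamma eta beta H j i)))).
  by move=> S H j; case: cid.
have [[i iN vi]|noi] := pselect (exists2 i, i \in N & 0 < v i); last first.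
  by exists None => k kN; rewrite leNgt; apply/negP => vk; apply: noi; exists k.
case: (@arg_maxP _ _ _ i (mem N) v iN) => m mN vm.
by exists (Some m); split => //; exact: lt_le_trans vi (vm i iN).
Qed.

Definition Gamma (R : realType) (C delta D : R) : R :=
  if expR 1 - 1 <= ln (Num.max delta D)
  then ln (delta * D) + 2 * ln (ln (Num.max delta D)) + C
  else C.

(* Main.v *)
(** Write [g l = Psi (1 - l / c) = eta * (q ^ l - 1)] with [q = beta ^ (1 / c)].
    Let [A] and [O] be the sets of jobs that the algorithm and an optimal
    solution put on a server of capacity [c].  By the choice rule, the optimum is
    at most the total of [r d - L] over the algorithm's assignments plus the
    total loss [L] over the assignments of the optimum, and [L <= r d] for each
    assignment of the algorithm.

    The loss of the optimum is charged to the algorithm.  A price is of the form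
    [rho * g l], where [l] jobs of [A] of rate at least [rho] are present.  Since
    [g l = (q - 1) * sum_(k < l) (g k + eta)] and the [k + 1]-st of these jobs was
    itself priced at least at [rho * g k], a price is at most [q - 1] times the
    sum of (price + eta * rate) over the jobs of [A] present.  Summing over the grid points of the jobs of [O] that arrive after a
    fixed job [h] of [A], at most about [c] such points fall in each step of the
    grid of [h]: there are at most [c] arrivals per unit of time, all durations
    being at least 1, so the average excess is a factor [1 + 2 / gamma], even on
    every initial segment, which suffices because prices decrease with time.
    Finally [c * (q - 1)] tends to [ln beta]. *)
Require Import Defs.
From mathcomp Require Import all_boot all_order all_algebra.
From mathcomp Require Import all_classical all_reals all_analysis.
From mathcomp Require Import ring lra.

Set Implicit Arguments.
Unset Strict Implicit.
Unset Printing Implicit Defensive.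

Import Order.TTheory GRing.Theory Num.Theory.
Local Open Scope ring_scope.

(** * Order statistics and prices in terms of the rates present *)

Lemma count_ge_nth (R : realType) (rs : seq R) (rho : R) (l : nat) :
  sorted >=%R rs -> (l < count (fun x => rho <= x)%R rs)%N -> rho <= nth 0 rs l.
Proof.
elim: rs l => [|x rs IH] l //= xrs.
have allx : all (fun y => y <= x) rs.
  by apply: order_path_min xrs => a b c ba cb; exact: le_trans cb ba.
case: l => [|l] /=; last first.
  rewrite -ltnS => h; apply: IH; first exact: path_sorted xrs.
  by move: h; case: (_ <= x) => //=; rewrite ?add1n ?add0n ?ltnS // => /ltnW.
case: (leP rho x) => //= xrho; rewrite add0n -has_count => /hasP[y yrs rhoy].
by move: (allP allx y yrs) => yx; have := le_lt_trans yx xrho; rewrite ltNge rhoy.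
Qed.

Lemma count_ge_nth_sorted (R : realType) (rs : seq R) (l : nat) :
  sorted >=%R rs -> (l < size rs)%N ->
  (l < count (fun x => nth 0 rs l <= x)%R rs)%N.
Proof.
elim: rs l => [|x rs IH] [|l] //= xrs; first by rewrite lexx.
rewrite ltnS => lrs.
have allx : all (fun y => y <= x) rs.
  by apply: order_path_min xrs => a b c ba cb; exact: le_trans cb ba.
rewrite (allP allx _ (mem_nth 0 lrs)) add1n ltnS.
exact: IH (path_sorted xrs) lrs.
Qed.

Section Price.
Variables (R : realType) (eta beta : R) (c : nat).
Hypotheses (eta_gt0 : 0 < eta) (beta_gt1 : 1 < beta) (c_gt0 : (0 < c)%N).

(** This is the [q] of the outline; [price_level] is its [g]. *)
Definition price_ratio : R := beta `^ (c%:R^-1).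

Definition price_level (l : nat) : R := eta * (price_ratio ^+ l - 1).

Lemma price_ratio_ge1 : 1 <= price_ratio.
Proof.
rewrite /price_ratio -[leLHS](powRr0 beta) ler_powR ?invr_ge0 //.
exact: ltW.
Qed.

Lemma price_ratio_expn : price_ratio ^+ c = beta.
Proof.
rewrite /price_ratio -powR_mulrn ?powR_ge0 // -powRrM mulVf ?powRr1 //.
  by rewrite (le_trans ler01) // ltW.
by rewrite pnatr_eq0 -lt0n.
Qed.

Lemma PsiE l : Psi eta beta (1 - l%:R / c%:R) = price_level l.
Proof.
rewrite /Psi /price_level /price_ratio; congr (_ * (_ - 1)).
by rewrite -powR_mulrn ?powR_ge0 // -powRrM; congr (_ `^ _); ring.
Qed.

Lemma price_level0 : price_level 0 = 0.
Proof. by rewrite /price_level expr0 subrr mulr0. Qed.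

Lemma price_levelS l :
  price_level l.+1 =
  price_level l + (price_ratio - 1) * (price_level l + eta).
Proof. by rewrite /price_level exprS; ring. Qed.

Lemma price_level_cap : price_level c = eta * (beta - 1).
Proof. by rewrite /price_level price_ratio_expn. Qed.

Lemma le_price_level l m : (l <= m)%N -> price_level l <= price_level m.
Proof.
move=> lm; rewrite /price_level ler_pM2l // lerD2r.
exact: ler_weXn2l price_ratio_ge1 _ _ lm.
Qed.

Lemma price_level_ge0 l : 0 <= price_level l.
Proof. by rewrite -price_level0 le_price_level. Qed.

Lemma GR_price_ge0 rs r : 0 <= r -> 0 <= GR_price eta beta c rs r.
Proof.
move=> r0; rewrite /GR_price.
by apply: le_trans (bigmax_ge_id _ _ _ _); rewrite PsiE price_level0 mulr0.
Qed.

(** Together with [GR_price_attained], this describes the price as the maximum of [rho * g l] over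
    [rho <= r] and [l] at most the number of rates [>= rho]. Order statistics are thus traded for
    counts, which are easy to compare between two times or two histories. *)
Lemma GR_price_ge rs r rho l : rho <= r -> sorted >=%R rs ->
  (l <= count (fun x => rho <= x)%R rs)%N ->
  rho * price_level l <= GR_price eta beta c rs r.
Proof.
move=> rhor srs lrs; rewrite /GR_price.
have lsz : (l < (size rs).+1)%N by rewrite ltnS (leq_trans lrs) // count_size.
apply: le_trans (le_bigmax_cond _ _ (j := Ordinal lsz) _) => //=.
rewrite PsiE ler_wpM2r ?price_level_ge0 //.
case: l lrs {lsz} => [|l] lrs //=.
by rewrite le_min rhor andbT; exact: count_ge_nth.
Qed.

Lemma GR_price_attained rs r : 0 <= r -> sorted >=%R rs -> all (>= 0) rs ->
  exists rho l, [/\ 0 <= rho, rho <= r,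
    (l <= count (fun x => rho <= x)%R rs)%N &
    GR_price eta beta c rs r = rho * price_level l].
Proof.
move=> r0 srs rs0; rewrite /GR_price.
have term (l : 'I_(size rs).+1) : exists rho k, [/\ 0 <= rho, rho <= r,
    (k <= count (fun x => rho <= x)%R rs)%N &
    capped_rate rs l r * Psi eta beta (1 - l%:R / c%:R) = rho * price_level k].
  exists (capped_rate rs l r), l; rewrite PsiE.
  case: l => -[|l] /= lsz; first by split.
  have nl : 0 <= nth 0 rs l by exact: (allP rs0 _ (mem_nth 0 lsz)).
  split => //; first by rewrite le_min nl.
    by rewrite ge_min lexx orbT.
  apply: leq_trans (count_ge_nth_sorted srs lsz) _.
  by apply: sub_count => x; apply: le_trans; rewrite ge_min lexx.
elim/big_ind: _ => //; first exact: (term ord0).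
by move=> x y Hx Hy; rewrite /Order.max; case: ifP.
Qed.

End Price.

(** * Summation by parts and counting *)

Lemma Abel_le (R : realType) (M : R) (n f : nat -> R) (N : nat) :
  (forall w, 0 <= f w) -> (forall w, f w.+1 <= f w) ->
  (forall v, \sum_(0 <= w < v) n w <= M * v%:R) ->
  \sum_(0 <= w < N) n w * f w <= M * \sum_(0 <= w < N) f w.
Proof.
move=> f0 fS nM.
(* The induction carries along the slack of the prefix bound, weighted by the current [f v]; since
   the slack is nonnegative, lowering the weight to [f v.+1] is harmless. *)
suff H v : f v * (M * v%:R - \sum_(0 <= w < v) n w) <=
    M * \sum_(0 <= w < v) f w - \sum_(0 <= w < v) n w * f w.
  rewrite -subr_ge0; apply: le_trans (H N).
  by rewrite mulr_ge0 // subr_ge0.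
elim: v => [|v IH]; first by rewrite !big_geq // !mulr0 subrr mulr0.
have X0 : 0 <= M * v.+1%:R - \sum_(0 <= w < v.+1) n w by rewrite subr_ge0.
have := ler_wpM2r X0 (fS v).
by rewrite !big_nat_recr //= -natr1; lra.
Qed.

Lemma sub_in_count (T : eqType) (P Q : pred T) (r : seq T) :
  {in r, forall x, P x -> Q x} -> (count P r <= count Q r)%N.
Proof.
move=> PQ; rewrite -(@eq_in_count _ (predI P (mem r))) => [|x xr /=].
  by apply: sub_count => x /andP[Px /PQ]; exact.
by rewrite xr andbT.
Qed.

Lemma count_leD (T : eqType) (P Q S : pred T) (r : seq T) :
  {in r, forall x, P x -> Q x || S x} -> (count P r <= count Q r + count S r)%N.
Proof.
move=> PQS; rewrite -count_predUI; apply: leq_trans (leq_addr _ _).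
exact: sub_in_count.
Qed.

Lemma sum_count (R : realType) (T : Type) (P : pred T) (r : seq T) :
  \sum_(x <- r) (P x)%:R = (count P r)%:R :> R.
Proof.
by rewrite -sum1_count natr_sum [RHS]big_mkcond; apply: eq_bigr => x _; case: (P x).
Qed.

(** * Packing of grid points into the windows of a fixed grid *)

Section Windows.
Variables (R : realType) (T : eqType) (O : seq T) (c : nat).
Variables (gamma : R) (s D : T -> R).
Hypotheses (gamma_gt0 : 0 < gamma) (s_ge0 : {in O, forall k, 0 <= s k}).
Hypothesis gammaD : {in O, forall k, gamma <= D k}.
Hypothesis depth : forall y, 0 <= y ->
  (count (fun k => (s k <= y) && (y < s k + D k))%R O <= c)%N.

(* All these intervals contain the largest of their left endpoints. *)
Lemma count_starts (u : R) : 0 <= u ->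
  (count (fun k => (u <= s k) && (s k < u + gamma))%R O <= c)%N.
Proof.
move=> u0; set P := fun k => _.
set y := \big[Num.max/u]_(k <- O | P k) s k.
have yu : y < u + gamma.
  by apply: bigmax_lt => [|k /andP[]] //; rewrite ltrDl.
have uy : u <= y by exact: bigmax_ge_id.
apply: leq_trans (depth (le_trans u0 uy)).
apply: sub_in_count => k kO Pk; apply/andP; split.
  exact: le_bigmax_seq.
move: Pk => /andP[usk _]; have := gammaD kO; lra.
Qed.

Lemma count_starts_lt (p : nat) :
  (count (fun k => s k < p%:R * gamma)%R O <= c * p)%N.
Proof.
elim: p => [|p IH].
  rewrite muln0 leqn0 -leqn0 leqNgt -has_count; apply/hasPn => k kO.
  by rewrite mul0r -leNgt s_ge0.
rewrite mulnS addnC.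
apply: leq_trans (leq_add IH (@count_starts (p%:R * gamma) _)); last first.
  by rewrite mulr_ge0 // ltW.
apply: count_leD => k _; rewrite -natr1 mulrDl mul1r.
by case: (ltP (s k) (p%:R * gamma)).
Qed.

(** Left endpoints are rounded down, lengths kept: this aligns the grids of all intervals with the
    integers. *)
Definition window_count (w : nat) : nat :=
  count (fun k => (Num.truncn (s k) <= w)%N && (w%:R < (Num.truncn (s k))%:R + D k)%R) O.

Lemma window_count_short (w : nat) : w.+1%:R <= gamma -> (window_count w <= c)%N.
Proof.
move=> wg; apply: leq_trans (count_starts (lexx 0)).
apply: sub_in_count => k kO /andP[kw _].
rewrite s_ge0 //= add0r; apply: lt_le_trans wg.
by rewrite -truncn_le_nat.
Qed.

(** An interval that covers [w] only because of the rounding must start in the window of [w], so the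
    excess over [c] is paid for by new starts. *)
Lemma window_count_le (w : nat) :
  (window_count w <= c + count (fun k => Num.truncn (s k) == w) O)%N.
Proof.
apply: leq_trans (leq_add (@depth w%:R _) (leqnn _)); last exact: ler0n.
apply: count_leD => k kO /andP[kw wD].
have /andP[tk _] := truncn_itv (s_ge0 kO).
move: kw; rewrite leq_eqVlt => /orP[->|kw]; first by rewrite orbT.
apply/orP; left; apply/andP; split; last by lra.
by apply: ltW; rewrite -truncn_lt_nat // s_ge0.
Qed.

Lemma sum_window_count (v : nat) :
  (\sum_(0 <= w < v) window_count w <=
   c * v + count (fun k => Num.truncn (s k) < v) O)%N.
Proof.
elim: v => [|v IH]; first by rewrite big_geq.
rewrite big_nat_recr //= mulnS [(c + _)%N]addnC -addnA.
apply: leq_trans (leq_add IH (window_count_le v)) _.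
rewrite -addnA leq_add2l addnCA leq_add2l.
rewrite -count_predUI (@eq_count _ (predI _ _) pred0) => [|k /=]; last first.
  by case: ltngtP.
by rewrite count_pred0 addn0; apply: sub_count => k /= /orP[/ltnW|/eqP ->].
Qed.

Lemma sum_window_countR (v : nat) :
  \sum_(0 <= w < v) (window_count w)%:R <= c%:R * (1 + 2 / gamma) * v%:R.
Proof.
have c0 : 0 <= c%:R :> R by [].
have v0 : 0 <= v%:R :> R by [].
have g0 : 0 <= gamma^-1 by rewrite invr_ge0 ltW.
(* Up to [gamma] there is no excess, as all intervals starting before [gamma] overlap. Beyond it,
   [v / gamma >= 1], so rounding the number of blocks of length [gamma] up costs at most a factor
   2. *)
have [vg|gv] := leP v%:R gamma.
  apply: (@le_trans _ _ (c%:R * v%:R)); last first.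
    by rewrite ler_wpM2r // ler_peMr // lerDl mulr_ge0.
  rewrite mulr_natr -[X in _ *+ X]subn0 -sumr_const_nat big_seq [leRHS]big_seq.
  apply: ler_sum => w; rewrite mem_index_iota /= => wv.
  by rewrite ler_nat window_count_short // (le_trans _ vg) // ler_nat.
rewrite -natr_sum; apply: (@le_trans _ _ (c * v + c * (Num.truncn (v%:R / gamma)).+1)%:R).
  rewrite ler_nat; apply: leq_trans (sum_window_count v) _.
  rewrite leq_add2l; apply: leq_trans (count_starts_lt _).
  apply: sub_in_count => k kO kv; rewrite -ltr_pdivrMr //; apply: le_lt_trans (truncnS_gt _).
  by rewrite ler_pM2r ?invr_gt0 // ltW // -truncn_lt_nat ?s_ge0.
rewrite natrD !natrM -natr1.
have /andP[+ _] := truncn_itv (mulr_ge0 v0 g0).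
have : 1 <= v%:R / gamma by rewrite ler_pdivlMr // mul1r ltW.
move: (Num.truncn _)%:R => /= x h1 h2.
have : c%:R * (x + 1) <= c%:R * (2 * (v%:R / gamma)) by rewrite ler_wpM2l //; lra.
lra.
Qed.

End Windows.

(* Window [w] of the grid of a fixed origin [t0] receives at most one point of
   the grid of each interval, namely the one of index [w - w_k], where [w_k] is
   the window of its left endpoint. *)
Lemma sum_grid_le (R : realType) (T : eqType) (O : seq T) (c : nat)
    (gamma t0 e : R) (t d : T -> R) (f : R -> R) :
  0 < gamma -> {in O, forall k, t0 <= t k} -> {in O, forall k, 1 <= d k} ->
  (forall y, t0 <= y ->
    (count (fun k => (t k <= y) && (y < t k + d k))%R O <= c)%N) ->
  (forall x, 0 <= f x) -> (forall x y, x <= y -> f y <= f x) ->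
  \sum_(k <- O) \sum_(tau <- grid gamma (t k) (t k + d k) | tau < e) f tau <=
  c%:R * (1 + 2 / gamma) * \sum_(tau <- grid gamma t0 e) f tau.
Proof.
move=> g0 tO dO depth f0 fmono.
have gV0 : 0 < gamma^-1 by rewrite invr_gt0.
(* Cutting [f] off to 0 from [e] on keeps it nonincreasing, as [Abel_le] requires. *)
pose F w := if t0 + w%:R / gamma < e then f (t0 + w%:R / gamma) else 0.
have F0 w : 0 <= F w by rewrite /F; case: ifP.
have FS w : F w.+1 <= F w.
  have le : t0 + w%:R / gamma <= t0 + w.+1%:R / gamma.
    by rewrite lerD2l ler_pM2r // ler_nat.
  rewrite /F; case: (ltP (t0 + w.+1%:R / gamma)) => h; last by case: ifP.
  by rewrite (le_lt_trans le h) fmono.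
set N := (Num.truncn (gamma * (e - t0))).+1.
have FN w : (N <= w)%N -> F w = 0.
  move=> Nw; rewrite /F ifF //; apply/negbTE; rewrite -leNgt.
  have : (N%:R <= w%:R :> R) by rewrite ler_nat.
  have := truncnS_gt (gamma * (e - t0)); rewrite -/N => h1 h2.
  rewrite -lerBlDl ler_pdivlMr // mulrC; lra.
have -> : \sum_(tau <- grid gamma t0 e) f tau = \sum_(0 <= w < N) F w.
  by rewrite /grid big_filter big_map big_mkcond /index_iota subn0.
(* Time is measured from [t0] in grid steps; durations of at least 1 become lengths of at least
   [gamma]. *)
pose s k := gamma * (t k - t0); pose D k := gamma * d k.
have s0 : {in O, forall k, 0 <= s k}.
  by move=> k kO; rewrite mulr_ge0 ?(ltW g0) // subr_ge0 tO.
have gD : {in O, forall k, gamma <= D k}.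
  by move=> k kO; rewrite /D ler_peMr ?dO // ltW.
have sdepth y : 0 <= y ->
    (count (fun k => (s k <= y) && (y < s k + D k))%R O <= c)%N.
  move=> y0; apply: leq_trans (depth (t0 + y / gamma) _); last first.
    by rewrite lerDl mulr_ge0 // ltW.
  apply/eq_leq/eq_count => k; rewrite /s /D -mulrDr; congr (_ && _).
    by rewrite -lerBlDl ler_pdivlMr // mulrC.
  by rewrite -ltrBrDl ltr_pdivrMr // [_ * gamma]mulrC addrAC.
apply: le_trans (Abel_le N F0 FS (sum_window_countR g0 s0 gD sdepth)).
rewrite /window_count.
under [leRHS]eq_bigr => w _ do rewrite -sum_count mulr_suml.
rewrite exchange_big /= big_seq [leRHS]big_seq; apply: ler_sum => k kO.
set wk := Num.truncn (s k).
set a := fun w => (wk <= w)%N && (w%:R < wk%:R + D k)%R.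
rewrite /grid big_filter_cond big_map big_mkcond.
set Nk := (Num.truncn _).+1.
(* [F] vanishes from [N] on, so the range may be extended to hold all [Nk] candidate grid indices
   shifted by [wk]. *)
have -> : \sum_(0 <= w < N) (a w)%:R * F w =
          \sum_(0 <= w < N + (wk + Nk)) (a w)%:R * F w.
  rewrite [RHS](@big_cat_nat _ _ _ N) ?leq_addr //=.
  rewrite [X in _ = _ + X]big_nat [X in _ = _ + X]big1 ?addr0 //.
  by move=> w /andP[Nw _]; rewrite FN // mulr0.
have aF0 w : 0 <= (a w)%:R * F w by rewrite mulr_ge0.
apply: (@le_trans _ _ (\sum_(wk <= w < wk + Nk) (a w)%:R * F w)); last first.
  rewrite (@big_cat_nat _ _ _ (wk + Nk) 0) ?leq_addl //=.
  rewrite (@big_cat_nat _ _ _ wk 0) ?leq_addr //=.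
  by rewrite addrAC lerDr addr_ge0 // sumr_ge0.
rewrite -{1}[wk]add0n big_addn addKn -[Nk in iota _ Nk]subn0.
apply: ler_sum => l _; case: ifP => [/andP[ld le]|_]; last by rewrite mulr_ge0.
have al : a (l + wk)%N.
  rewrite /a leq_addl natrD addrC ltrD2l /D.
  by move: ld; rewrite ltrD2l ltr_pdivrMr // mulrC.
(* The grid point lies no earlier than the left end of its window, so [f] is no larger there. *)
have lele : t0 + (l + wk)%:R / gamma <= t k + l%:R / gamma.
  have /andP[+ _] := truncn_itv (s0 _ kO).
  rewrite -/wk /s mulrC -ler_pdivrMr // natrD mulrDl; lra.
by rewrite al mul1r /F (le_lt_trans lele le) fmono.
Qed.

(** * Active rates, grid sizes and reordering of sums *)

Lemma active_rates_sorted (R : realType) (n : nat) (H : history R n) i tau :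
  sorted >=%R (active_rates H i tau).
Proof. by apply: sort_sorted => x y; exact: le_total. Qed.

Lemma count_active_rates (R : realType) (n : nat) (H : history R n) i tau p :
  count p (active_rates H i tau) =
  count (fun ja => unfinished i tau ja && p (rate ja.1 i)) H.
Proof.
have /permP -> : perm_eq (active_rates H i tau)
    [seq rate ja.1 i | ja <- H & unfinished i tau ja] by rewrite perm_sort.
by rewrite count_map count_filter; apply: eq_count => ja /=; rewrite andbC.
Qed.

Lemma size_grid (R : realType) (gamma t d : R) : 0 < gamma -> 0 <= d ->
  (size (grid gamma t (t + d)))%:R <= gamma * d + 1.
Proof.
move=> g0 d0; rewrite size_filter.
apply: (@le_trans _ _ (Num.truncn (gamma * (t + d - t))).+1%:R).
  by rewrite ler_nat; apply: leq_trans (count_size _ _) _; rewrite size_map size_iota.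
rewrite -natr1 lerD2r addrAC subrr add0r.
by have /andP[] := truncn_itv (mulr_ge0 (ltW g0) d0).
Qed.

(** Regroups the charges: from the job [k] of the optimum whose loss is charged to the earlier job
    [h] of the algorithm that pays for it. *)
Lemma exchange_triangle (R : realType) (T : Type) (m : nat) (a b : pred nat)
    (G : nat -> seq T) (Q : nat -> pred T) (f : nat -> T -> R) :
  \sum_(0 <= k < m | b k) \sum_(tau <- G k)
    \sum_(0 <= h < k | a h && Q h tau) f h tau =
  \sum_(0 <= h < m | a h) \sum_(0 <= k < m | b k && (h < k)%N)
    \sum_(tau <- G k | Q h tau) f h tau.
Proof.
rewrite [RHS](exchange_big_dep b) /=; last by move=> h k _ /andP[].
rewrite [LHS]big_nat_cond [RHS]big_nat_cond.
apply: eq_bigr => k /andP[/andP[_ km] bk].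
under eq_bigr => tau _.
  rewrite (@big_nat_widen _ _ _ 0 k m _ _ (ltnW km)). over.
rewrite (exchange_big_dep (fun h => a h && (h < k)%N)) /=; last first.
  by move=> tau h _ /andP[/andP[-> _] ->].
rewrite bk /=; apply: eq_bigr => h /andP[-> ->].
by apply: eq_bigl => tau; rewrite andbT.
Qed.

(** * Charging the losses of the optimum on one server *)

Section SingleServer.
Variables (R : realType) (n : nat) (gamma eta beta K : R).
Variables (J : nat -> job R n) (al op : nat -> option 'I_n) (m : nat).
Variables (i : 'I_n) (c : nat).
Hypotheses (gamma_gt0 : 0 < gamma) (eta_gt0 : 0 < eta) (beta_gt1 : 1 < beta).
Hypotheses (c_gt0 : (0 < c)%N) (cK : c%:R * (price_ratio beta c - 1) <= K).

Definition hist (k : nat) : history R n := [seq (J h, al h) | h <- iota 0 k].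

Definition price_at (k : nat) (tau : R) : R :=
  GR_price eta beta c (active_rates (hist k) i tau) (rate (J k) i).

Definition occupies (h : nat) (tau : R) : bool := unfinished i tau (J h, al h).

Hypothesis rate_al :
  forall h, (h < m)%N -> al h = Some i -> 0 < rate (J h) i.

Lemma active_rates_ge0 k tau : (k <= m)%N ->
  all (>= 0) (active_rates (hist k) i tau).
Proof.
move=> km; rewrite /active_rates all_sort all_map; apply/allP => ja.
rewrite mem_filter => /andP[/andP[/eqP jai _] /mapP[h]].
rewrite mem_iota add0n => /andP[_ hk] jaE; rewrite jaE /= in jai *.
exact/ltW/rate_al/jai/leq_trans/km.
Qed.

Lemma price_at_ge0 k tau : 0 <= rate (J k) i -> 0 <= price_at k tau.
Proof. exact: GR_price_ge0. Qed.

(** Jobs of a fixed history only leave as time passes, so the [rho] and [l] attaining the price at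
    [tau'] are still admissible at [tau]. *)
Lemma price_at_mono k tau tau' : (k <= m)%N -> 0 <= rate (J k) i ->
  tau <= tau' -> price_at k tau' <= price_at k tau.
Proof.
move=> km rk tt.
have [rho [l [rho0 rhor lc]]] := GR_price_attained eta beta c rk
  (active_rates_sorted (hist k) i tau') (active_rates_ge0 tau' km).
rewrite /price_at => ->; apply: GR_price_ge => //.
  exact: active_rates_sorted.
apply: leq_trans lc _; rewrite !count_active_rates.
rewrite /unfinished; apply: sub_count => ja /= /andP[/andP[-> lt] ->]; rewrite andbT /=.
exact: le_lt_trans tt lt.
Qed.

(* The [l]-th of the jobs of rate at least [rho] present at [tau] was itself
   priced against the [l - 1] previous ones. *)
Lemma level_charge k tau rho : (k <= m)%N -> 0 <= rho ->
  c%:R * (rho * price_level eta beta c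
    (count (fun h => occupies h tau && (rho <= rate (J h) i)) (iota 0 k))) <=
  K * \sum_(0 <= h < k | occupies h tau) (price_at h tau + eta * rate (J h) i).
Proof.
move=> + rho0; elim: k => [_|k IH km].
  by rewrite big_geq // price_level0 !mulr0.
have K0 : 0 <= K.
  by apply: le_trans cK; rewrite mulr_ge0 // subr_ge0 price_ratio_ge1.
rewrite -[in iota 0 k.+1]addn1 iotaD count_cat /= add0n addn0.
rewrite big_mkcond big_nat_recr //= -big_mkcond /=.
case occ : (occupies k tau) => /=; last by rewrite addn0 addr0 IH // ltnW.
have rk : 0 < rate (J k) i by move: occ => /andP[/eqP aki _]; exact: rate_al.
have := IH (ltnW km); set l := count _ _ => {}IH.
have P0 := price_at_ge0 tau (ltW rk).
case: (leP rho (rate (J k) i)) => rhok; last first.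
  rewrite addn0 mulrDr (le_trans IH) // lerDl mulr_ge0 // addr_ge0 //.
  by rewrite mulr_ge0 // ltW.
rewrite addn1 price_levelS.
have Pk : rho * price_level eta beta c l <= price_at k tau.
  apply: GR_price_ge => //; first exact: active_rates_sorted.
  by rewrite count_active_rates count_map.
have lev : rho * (price_level eta beta c l + eta) <=
    price_at k tau + eta * rate (J k) i.
  by rewrite mulrDr lerD // mulrC ler_wpM2l // ltW.
have lev0 : 0 <= rho * (price_level eta beta c l + eta).
  by rewrite mulr_ge0 // addr_ge0 ?price_level_ge0 // ltW.
have := ler_pM _ lev0 cK lev; rewrite mulr_ge0 ?subr_ge0 ?price_ratio_ge1 //.
by move=> /(_ isT); lra.
Qed.

Lemma price_charge k tau : (k <= m)%N -> 0 <= rate (J k) i ->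
  c%:R * price_at k tau <=
  K * \sum_(0 <= h < k | occupies h tau) (price_at h tau + eta * rate (J h) i).
Proof.
move=> km rk.
have [rho [l [rho0 rhor lc]]] := GR_price_attained eta beta c rk
  (active_rates_sorted (hist k) i tau) (active_rates_ge0 tau km).
rewrite /price_at => ->; apply: le_trans (level_charge tau km rho0).
rewrite ler_wpM2l // ler_wpM2l // le_price_level //.
by apply: leq_trans lc _; rewrite count_active_rates count_map.
Qed.

Definition loss_at (k : nat) : R :=
  \sum_(tau <- grid gamma (arr (J k)) (arr (J k) + dur (J k) i)) price_at k tau.

Hypothesis rate_op :
  forall k, (k < m)%N -> op k = Some i -> 0 < rate (J k) i.
Hypothesis dur_al :
  forall h, (h < m)%N -> al h = Some i -> 1 <= dur (J h) i.
Hypothesis dur_op :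
  forall k, (k < m)%N -> op k = Some i -> 1 <= dur (J k) i.
Hypothesis arr_ge0 : forall k, (k < m)%N -> 0 <= arr (J k).
Hypothesis arr_mono :
  forall h k, (h <= k)%N -> (k < m)%N -> arr (J h) <= arr (J k).
Hypothesis op_cap : forall t, 0 <= t ->
  (count (fun k => (op k == Some i) &&
    ((arr (J k) <= t) && (t < arr (J k) + dur (J k) i))%R) (iota 0 m) <= c)%N.

Lemma loss_charge :
  \sum_(0 <= k < m | op k == Some i) loss_at k <=
  K * (1 + 2 / gamma) * \sum_(0 <= h < m | al h == Some i)
    (loss_at h + (1 + gamma^-1) * (eta * gamma) * (rate (J h) i * dur (J h) i)).
Proof.
have c0 : 0 < c%:R :> R by rewrite ltr0n.
have gV0 : 0 < gamma^-1 by rewrite invr_gt0.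
have K0 : 0 <= K.
  by apply: le_trans cK; rewrite mulr_ge0 // subr_ge0 price_ratio_ge1.
pose f h tau := price_at h tau + eta * rate (J h) i.
pose G k := grid gamma (arr (J k)) (arr (J k) + dur (J k) i).
(* The factor [c] consumed by [price_charge] on the left reappears on the right from
   [sum_grid_le]. *)
rewrite -(ler_pM2l c0).
apply: (@le_trans _ _ (K * \sum_(0 <= k < m | op k == Some i)
    \sum_(tau <- G k) \sum_(0 <= h < k | occupies h tau) f h tau)).
  rewrite !mulr_sumr big_nat_cond [leRHS]big_nat_cond.
  apply: ler_sum => k /andP[km /eqP opk].
  rewrite !mulr_sumr; apply: ler_sum => tau _.
  by apply: price_charge; [exact: ltnW|exact/ltW/rate_op].
have /= -> := @exchange_triangle _ _ m (fun h => al h == Some i)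
  (fun k => op k == Some i) G (fun h tau => tau < arr (J h) + dur (J h) i) f.
rewrite -mulrA mulrCA ler_wpM2l // mulrA mulr_sumr.
rewrite big_nat_cond [leRHS]big_nat_cond; apply: ler_sum => h /andP[/= hm /eqP alh].
have rh := rate_al hm alh; have dh := dur_al hm alh.
have rh0 := ltW rh.
rewrite -big_filter.
set O := [seq k <- _ | _].
have memO k : k \in O -> [/\ op k = Some i, (h < k)%N & (k < m)%N].
  by rewrite mem_filter mem_index_iota /= => /andP[/andP[/eqP]].
apply: (le_trans (@sum_grid_le _ _ O c gamma (arr (J h)) (arr (J h) + dur (J h) i)
  (fun k => arr (J k)) (fun k => dur (J k) i) (f h) _ _ _ _ _ _)) => //.
- by move=> k /memO[_ hk km]; exact: arr_mono (ltnW hk) km.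
- by move=> k /memO[opk _ km]; exact: dur_op.
- move=> y yh; apply: leq_trans (op_cap (le_trans (arr_ge0 hm) yh)).
  rewrite count_filter /index_iota subn0; apply: sub_count => k /=.
  by move=> /andP[-> /andP[-> _]].
- by move=> x; rewrite /f addr_ge0 ?price_at_ge0 // mulr_ge0 // ltW.
- by move=> x y xy; rewrite /f lerD2r price_at_mono // ltnW.
apply: ler_wpM2l; first by rewrite mulr_ge0 // addr_ge0 // mulr_ge0 // ltW.
rewrite big_split /= lerD2l big_const_seq count_predT iter_addr_0 -mulr_natr.
apply: (@le_trans _ _ (eta * rate (J h) i * (gamma * dur (J h) i + 1))).
  by rewrite ler_wpM2l ?mulr_ge0 ?size_grid ?ltW // (lt_le_trans ltr01).
(* Origin of [1 + gamma^-1]: the extra grid point in [gamma * d + 1] is absorbed using [1 <= d]. *)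
have -> : (1 + gamma^-1) * (eta * gamma) * (rate (J h) i * dur (J h) i) =
    eta * rate (J h) i * (gamma * dur (J h) i + dur (J h) i).
  by field; exact: lt0r_neq0.
by rewrite ler_wpM2l ?lerD2l // mulr_ge0 // ltW.
Qed.

End SingleServer.

(** * Feasibility and reward of a whole run *)

Lemma sum_option (R : realType) (n m : nat) (op : nat -> option 'I_n)
    (F : nat -> 'I_n -> R) :
  \sum_(0 <= k < m) (if op k is Some i then F k i else 0) =
  \sum_i \sum_(0 <= k < m | op k == Some i) F k i.
Proof.
rewrite (exchange_big_dep predT) //=; apply: eq_bigr => k _.
case: (op k) => [i|]; last by rewrite big_pred0.
by rewrite (big_pred1 i) // => l; rewrite [in RHS]eq_sym.
Qed.

Section Run.
Variables (R : realType) (delta D gamma eta beta : R) (A : algorithm R).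
Hypotheses (delta_gt0 : 0 < delta) (gamma_gt0 : 0 < gamma) (eta_gt0 : 0 < eta).
Hypotheses (beta_gt1 : 1 < beta) (AP : is_GR_BAL gamma eta beta A).
Variables (S : servers) (I : seq (job R (nserv S))).
Hypotheses (instI : instance I) (locI : locally_bounded delta D I).

Let job0 : job R (nserv S) := Job 0 finset.set0 (fun=> 0) (fun=> 0).
Let J (k : nat) : job R (nserv S) := nth job0 I k.

(** Indexing decisions by position gives the run and an offline assignment the same form
    [H op m]. *)
Definition decision (k : nat) : option 'I_(nserv S) :=
  A (run A (take k I)) (J k).

Let H := hist J.
Let m := size I.
Let loss (i : 'I_(nserv S)) (k : nat) : R :=
  loss_at gamma eta beta J decision i (cap i) k.
Let gain (k : nat) (i : 'I_(nserv S)) : R := rate (J k) i * dur (J k) i.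

Lemma hist_nth (a : seq (option 'I_(nserv S))) : size a = m ->
  zip I a = H (nth None a) m.
Proof.
move=> sa; rewrite /H /hist -/(mkseq _ m).
rewrite -[LHS](mkseq_nth (job0, None)) size_zip sa minnn.
by apply: eq_mkseq => k; rewrite nth_zip.
Qed.

Lemma run_hist k : (k <= m)%N -> run A (take k I) = H decision k.
Proof.
elim: k => [|k IH] km; first by rewrite take0.
have Jx := take_nth job0 km.
rewrite Jx /run foldl_rcons -/(run _ _) -/(J k) -/(decision k) IH ?(ltnW km) //.
by rewrite /H /hist -[in RHS]addn1 iotaD map_cat /= cats1.
Qed.

Lemma nth_job k : (k < m)%N -> J k \in I.
Proof. exact: mem_nth. Qed.

Lemma decisionP k : (k < m)%N ->
  balance_choice (nbr (J k)) (fun i => gain k i - loss i k) (decision k).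
Proof.
move=> km; have := AP (run A (take k I)) (J k).
by rewrite -/(decision k) (run_hist (ltnW km)).
Qed.

Lemma decision_nbr k i : (k < m)%N -> decision k = Some i -> i \in nbr (J k).
Proof. by move=> /decisionP + di; rewrite di => -[]. Qed.

Lemma job_rate k i : (k < m)%N -> i \in nbr (J k) -> 0 < rate (J k) i.
Proof. by case: instI => _ _ h km iN; case: (h _ _ (nth_job km) iN). Qed.

Lemma job_dur k i : (k < m)%N -> i \in nbr (J k) -> 1 <= dur (J k) i <= D.
Proof. by case: locI => h _ km iN; exact: h _ _ (nth_job km) iN. Qed.

Lemma job_arr_ge0 k : (k < m)%N -> 0 <= arr (J k).
Proof. by case: instI => _ h _ km; exact: h (nth_job km). Qed.

Lemma job_arr_mono h k : (h <= k)%N -> (k < m)%N -> arr (J h) <= arr (J k).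
Proof.
case: instI => sI _ _ hk km; have hm := leq_ltn_trans hk km.
have := sorted_leq_nth le_trans (@lexx _ R) 0 sI.
move=> /(_ h k); rewrite !inE size_map => /(_ hm km hk).
by rewrite !(nth_map job0).
Qed.

Lemma gain_gt0 k i : (k < m)%N -> i \in nbr (J k) -> 0 < gain k i.
Proof.
move=> km iN; rewrite mulr_gt0 ?job_rate //.
by have /andP[+ _] := job_dur km iN; exact: lt_le_trans.
Qed.

Lemma decision_rate i h : (h < m)%N -> decision h = Some i -> 0 < rate (J h) i.
Proof. by move=> hm dh; rewrite job_rate // decision_nbr. Qed.

Lemma present_count op i t k :
  count (fun ja => (arr ja.1 <= t)%R && unfinished i t ja) (H op k) =
  count (fun h => (op h == Some i) &&
    ((arr (J h) <= t) && (t < arr (J h) + dur (J h) i))%R) (iota 0 k).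
Proof.
rewrite count_map; apply: eq_count => h /=.
by rewrite /unfinished /= andbCA.
Qed.

Hypothesis full_price : delta * D <= eta * (beta - 1).

(* Every job holding a unit of [i] when job [k] arrives has rate at least
   [rate (J k) i / delta], so at full capacity the first grid point alone costs
   [rate (J k) i / delta * eta * (beta - 1) >= rate (J k) i * D]. *)
Lemma full_server_rejects i k : (k < m)%N -> decision k = Some i ->
  (count (fun ja => unfinished i (arr (J k)) ja) (H decision k) < cap i)%N.
Proof.
move=> km dk; rewrite ltnNge; apply/negP => full.
have iN := decision_nbr km dk.
have rk := job_rate km iN; have /andP[d1 dD] := job_dur km iN.
have := decisionP km; rewrite dk => -[_ + _]; rewrite subr_gt0 ltNge => /negP; apply.
have d0 : 0 < dur (J k) i by exact: lt_le_trans d1.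
have P0 tau : 0 <= price_at eta beta J decision i (cap i) k tau.
  by apply: price_at_ge0 => //; exact: ltW.
rewrite /loss /loss_at /grid big_filter big_map big_mkcond /= big_cons.
rewrite mul0r addr0 ltrDl d0.
apply: (@le_trans _ _ (rate (J k) i / delta * price_level eta beta (cap i) (cap i))).
  rewrite price_level_cap ?cap_ge1 // -mulrA /gain ler_pM2l // ler_pdivlMl //.
  by apply: le_trans full_price; rewrite ler_pM2l.
apply: ler_wpDr; first by apply: sumr_ge0 => tau _; case: ifP.
apply: GR_price_ge => //.
(* Comparing job [k] with itself in the local bound yields [1 <= delta]. *)
- have delta1 : 1 <= delta.
    have := locI.2 _ _ _ (nth_job km) (nth_job km) iN iN.
    rewrite subrr normr0 divff ?lt0r_neq0 // => h.
    by case/andP: (h (le_trans (ltW d0) dD)).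
  by rewrite ler_pdivrMr // ler_peMr // ltW.
- exact: active_rates_sorted.
apply: leq_trans full _; rewrite count_active_rates.
apply: sub_in_count => ja /mapP[h]; rewrite mem_iota add0n => /andP[_ hk] -> /= .
move=> /[dup] unf ->; move: unf => /andP[/eqP /= dh lt].
have hm := ltn_trans hk km; have hN := decision_nbr hm dh.
have /andP[_ dhD] := job_dur hm hN.
(* Job [h] is still running when [k] arrives and lasts at most [D], so the two arrivals are close
   enough for the local bound. *)
have := locI.2 _ _ _ (nth_job km) (nth_job hm) iN hN.
have hk' := job_arr_mono (ltnW hk) km.
rewrite ger0_norm ?subr_ge0 // => /(_ _)/andP[]; first lra.
by move=> _; rewrite ler_pdivrMr ?job_rate // ler_pdivrMr // mulrC.
Qed.

Lemma run_feasible : feasible (run A I).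
Proof.
rewrite -[I in run A I]take_size run_hist //; split.
  move=> j i /mapP[k]; rewrite mem_iota add0n => /andP[_ km] [-> dk].
  exact: decision_nbr.
move=> i t _; suff cnt k : (k <= m)%N -> (count (fun ja =>
    (arr ja.1 <= t)%R && unfinished i t ja) (H decision k) <= cap i)%N by exact: cnt.
elim: k => [|k IH] km //.
rewrite /H /hist -[k.+1]addn1 iotaD map_cat count_cat /= addn0 add0n -/(hist J decision k) -/H.
case: (boolP (_ && _)) => [/andP[kt /andP[/eqP dk tk]]|_]; last first.
  by rewrite addn0 IH // ltnW.
(* Earlier jobs unfinished at [t] were also unfinished when [k] arrived, and [k] was accepted, so
   they number less than [cap i]. *)
rewrite addn1; apply: leq_ltn_trans (full_server_rejects km dk).
apply: sub_count => ja /andP[_ /andP[/= jai lt]].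
by rewrite /unfinished jai (le_lt_trans kt lt).
Qed.

Variable K : R.
Hypotheses (K_ge1 : 1 <= K)
  (capK : forall i, (@cap S i)%:R * (price_ratio beta (cap i) - 1) <= K).

Lemma loss_ge0 i k : 0 <= rate (J k) i -> 0 <= loss i k.
Proof. by move=> rk; apply: sumr_ge0 => tau _; exact: price_at_ge0. Qed.

Lemma reward_hist op : reward (H op m) =
  \sum_i \sum_(0 <= k < m | op k == Some i) gain k i.
Proof. by rewrite -sum_option /reward big_map /index_iota subn0. Qed.

Lemma reward_le (op : nat -> option 'I_(nserv S)) : feasible (H op m) ->
  reward (H op m) <=
  K * (1 + 2 / gamma) * (1 + (1 + gamma^-1) * (eta * gamma)) * ALG A I.
Proof.
move=> [opN opcap].
have {}opN k i : (k < m)%N -> op k = Some i -> i \in nbr (J k).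
  move=> km opk; apply: opN; apply/mapP; exists k; last by rewrite opk.
  by rewrite mem_iota.
pose profit k := if decision k is Some i then gain k i - loss i k else 0.
rewrite /ALG -[I in run A I]take_size run_hist // !reward_hist.
apply: (@le_trans _ _ (\sum_(0 <= k < m) profit k +
    \sum_i \sum_(0 <= k < m | op k == Some i) loss i k)).
  rewrite -!sum_option -big_split /= big_nat_cond [leRHS]big_nat_cond.
  apply: ler_sum => k /andP[/= km _].
  have := decisionP km; rewrite /profit.
  case dk : (decision k) => [i|] /=.
    move=> [iN gl mx]; case opk : (op k) => [l|]; last by rewrite addr0 ltW.
    by rewrite -lerBlDr mx // opN.
  move=> mx; case opk : (op k) => [l|]; rewrite add0r //.
  by rewrite -subr_le0 mx // opN.
rewrite sum_option.
set X := 1 + _ * _; set Y := 1 + 2 / gamma.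
have Y1 : 1 <= Y by rewrite lerDl mulr_ge0 // invr_ge0 ltW.
have charge i : \sum_(0 <= k < m | op k == Some i) loss i k <=
    K * Y * \sum_(0 <= h < m | decision h == Some i)
      (loss i h + (1 + gamma^-1) * (eta * gamma) * gain h i).
  apply: loss_charge => //.
  - exact: cap_ge1.
  - exact: decision_rate.
  - by move=> k km opk; rewrite job_rate // opN.
  - by move=> h hm dh; case/andP: (job_dur hm (decision_nbr hm dh)).
  - by move=> h hm dh; case/andP: (job_dur hm (opN _ _ hm dh)).
  - exact: job_arr_ge0.
  - exact: job_arr_mono.
  - by move=> t t0; rewrite -present_count opcap.
apply: le_trans (lerD (lexx _) (ler_sum _ (fun i _ => charge i))) _.
rewrite -big_split mulr_sumr /=; apply: ler_sum => i _.
rewrite !mulr_sumr -big_split /= big_nat_cond [leRHS]big_nat_cond.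
apply: ler_sum => k /andP[/= km /eqP dk].
have := decisionP km; rewrite dk => -[iN gl _].
(* Raising the coefficient of the nonnegative [gain - loss] from 1 to [K * Y] makes the losses
   cancel. *)
have KY : 0 <= K * Y - 1 by rewrite subr_ge0 mulr_ege1.
have := mulr_ge0 KY (ltW gl); rewrite /X; move: (K * Y) => a.
by move: (_ * (eta * gamma)) => b; lra.
Qed.

Lemma ALG_ge0 : 0 <= ALG A I.
Proof.
rewrite /ALG -[I in run A I]take_size run_hist // reward_hist.
apply: sumr_ge0 => i _; rewrite big_nat_cond sumr_ge0 // => k /andP[/= km /eqP dk].
by rewrite ltW // gain_gt0 // decision_nbr.
Qed.

Lemma OPT_le : OPT I <=
  K * (1 + 2 / gamma) * (1 + (1 + gamma^-1) * (eta * gamma)) * ALG A I.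
Proof.
apply: bigmax_le => [|a /asboolP feas].
  by rewrite !mulr_ge0 ?ALG_ge0 ?addr_ge0 ?mulr_ge0 ?invr_ge0 ?addr_ge0 ?invr_ge0 // ltW //
     (lt_le_trans ltr01).
rewrite hist_nth ?size_tuple // in feas *.
exact: reward_le.
Qed.

End Run.

(** * Large capacities and choice of the parameters *)

(** With [b = ln beta], the bound [expR (- x) >= 1 - x] at [x = b / c] gives [q <= c / (c - b)],
    hence [c * (q - 1) <= c * b / (c - b)]; this is at most [b + 1] exactly when
    [c >= b ^ 2 + b]. *)
Lemma price_ratio_limit (R : realType) (beta : R) (c : nat) : 1 < beta ->
  ln beta ^+ 2 + ln beta <= c%:R -> c%:R * (price_ratio beta c - 1) <= ln beta + 1.
Proof.
move=> beta1; set b := ln beta => bc.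
have b0 : 0 < b by exact: ln_gt0.
have c0 : 0 < c%:R :> R by apply: lt_le_trans bc; rewrite addr_gt0 ?exprn_gt0.
have cb : 0 < c%:R - b by rewrite subr_gt0 (lt_le_trans _ bc) // ltrDr exprn_gt0.
have -> : price_ratio beta c = expR (b / c%:R).
  by rewrite /price_ratio /powR gt_eqF ?(lt_trans ltr01) // mulrC.
have e0 := expR_gt0 (b / c%:R).
have : expR (b / c%:R) * (c%:R - b) <= c%:R.
  have := expR_ge1Dx (- (b / c%:R)); rewrite expRN => h.
  have := ler_wpM2l (ltW e0) h; rewrite divff ?gt_eqF // => {}h.
  have -> : expR (b / c%:R) * (c%:R - b) =
      expR (b / c%:R) * (1 + - (b / c%:R)) * c%:R by field; rewrite gt_eqF.
  by rewrite ler_piMl // ltW.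
move: (expR _) e0 => q q0 qc.
rewrite -(ler_pM2r cb).
have -> : c%:R * (q - 1) * (c%:R - b) = c%:R * (q * (c%:R - b) - (c%:R - b)) by ring.
apply: (@le_trans _ _ (c%:R * b)); first by rewrite ler_pM2l //; lra.
move: bc; rewrite expr2; nra.
Qed.

Lemma GR_BAL_competitive (R : realType) (delta D gamma eta beta G : R)
    (A : algorithm R) :
  1 <= delta -> 0 < gamma -> 0 < eta -> 1 < beta ->
  delta * D <= eta * (beta - 1) ->
  (ln beta + 1) * (1 + 2 / gamma) * (1 + (1 + gamma^-1) * (eta * gamma)) <= G ->
  is_GR_BAL gamma eta beta A ->
  feasible_policy delta D A /\ asymptotically_competitive delta D A G.
Proof.
move=> delta1 gamma0 eta0 beta1 full leG AP.
have delta0 := lt_le_trans ltr01 delta1.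
have b0 := ln_gt0 beta1; have gV0 : 0 < gamma^-1 by rewrite invr_gt0.
split=> [S I instI locI|].
  exact: (run_feasible delta0 eta0 beta1 AP instI locI full).
(* Thanks to the slack 1 in [ln beta + 1], the ratio is bounded by [G] for all capacities from [N]
   on, so this one set of the filter suffices. *)
pose N := (Num.truncn (ln beta ^+ 2 + ln beta)).+1.
have G0 : 0 <= G.
  apply: le_trans leG.
  by rewrite mulr_ge0 ?mulr_ge0 ?addr_ge0 ?mulr_ge0 ?addr_ge0 // ltW.
pose V := [set S | forall i, (N <= @cap S i)%N]%classic.
apply: ge_ereal_inf; exists (ereal_sup (worst_ratio delta D A @` V)%classic).
  by exists V => //; exists N.
apply/ereal_supP => _ [S capN <-]; apply/ereal_supP => _ [I [instI locI OPT0] <-].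
have OPTG : OPT I <= G * ALG A I.
  have capK i : (@cap S i)%:R * (price_ratio beta (cap i) - 1) <= ln beta + 1.
    apply: price_ratio_limit => //; apply: (le_trans (ltW (truncnS_gt _))).
    by rewrite ler_nat; exact: capN.
  have K1 : 1 <= ln beta + 1 by rewrite lerDr ltW.
  have := OPT_le gamma0 eta0 beta1 AP instI locI K1 capK.
  move/le_trans; apply; rewrite ler_wpM2r //.
  exact: (ALG_ge0 AP instI locI).
have OPTgt0 : 0 < OPT I by rewrite lt_def OPT0 bigmax_ge_id.
have ALG0 : 0 < ALG A I.
  rewrite ltNge; apply/negP => ALGle0.
  by have := le_lt_trans (mulr_ge0_le0 G0 ALGle0) (lt_le_trans OPTgt0 OPTG); rewrite ltxx.
by rewrite inver gt_eqF // -EFinM lee_fin ler_pdivrMr.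
Qed.

(* With [P = delta * D], the threshold [eta * (beta - 1) = P] is exactly what
   feasibility needs; [gamma = 2 * y] and [eta * gamma = 1 / y] keep the factors
   lost to discretization and to the linear term of the price below
   [1 + O(1 / y)], while [ln beta <= ln P + 2 * ln y + O(1)]. *)
Lemma GR_BAL_tuning (R : realType) (P y : R) : 1 <= P -> 1 <= y ->
    ln P <= 2 * y ->
  let gamma := 2 * y in let eta := (2 * y ^+ 2)^-1 in
  let beta := 1 + 2 * y ^+ 2 * P in
  (ln beta + 1) * (1 + 2 / gamma) * (1 + (1 + gamma^-1) * (eta * gamma)) <=
  ln P + 2 * ln y + 23.
Proof.
move=> P1 y1 lnP /=; set beta := 1 + _.
have y0 := lt_le_trans ltr01 y1; have P0 := lt_le_trans ltr01 P1.
have y2 : 1 <= y ^+ 2 by rewrite exprn_ege1.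
have lnbeta : ln beta <= 2 + 2 * ln y + ln P.
  have y2P : 1 <= y ^+ 2 * P by rewrite mulr_ege1.
  apply: (@le_trans _ _ (ln (3 * (y ^+ 2 * P)))).
    by rewrite ler_ln ?qualifE /= /beta //; lra.
  rewrite expr2 !lnM ?qualifE //= ?mulr_gt0 //.
  have : ln 3 <= 2 :> R.
    by rewrite (_ : 3 = 1 + 2) ?le_ln1Dx //; lra.
  lra.
have lny : ln y <= y - 1 by rewrite -[X in ln X](subrKC 1) le_ln1Dx //; lra.
have b0 : 0 <= ln beta.
  apply: ln_ge0; rewrite /beta lerDl mulr_ge0 ?mulr_ge0 ?exprn_ge0 //; exact: ltW.
set u := y^-1.
have u0 : 0 < u by rewrite invr_gt0.
have u1 : u <= 1 by rewrite invf_le1.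
have yu : y * u = 1 by rewrite divff ?gt_eqF.
have -> : 1 + 2 / (2 * y) = 1 + u by rewrite /u; field; rewrite gt_eqF.
have -> : 1 + (1 + (2 * y)^-1) * ((2 * y ^+ 2)^-1 * (2 * y)) = 1 + (1 + u / 2) * u.
  by rewrite /u; field; rewrite gt_eqF.
have factor : (1 + u) * (1 + (1 + u / 2) * u) <= 1 + 4 * u by nra.
rewrite -mulrA; apply: (@le_trans _ _ ((ln beta + 1) * (1 + 4 * u))).
  by rewrite ler_wpM2l // addr_ge0.
(* Here [ln beta + 1 <= 4 * y + 1 <= 5 * y]. The excess [4 * u] thus costs at most 20, which with
   the 3 in [ln beta + 1 <= ln P + 2 * ln y + 3] makes 23. *)
have : (ln beta + 1) * u <= 5.
  by apply: (@le_trans _ _ (5 * y * u)); [rewrite ler_pM2r //; lra|lra].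
lra.
Qed.

Theorem theorem5 (R : realType) :
  exists C : R, forall delta D : R, (1 <= delta)%R -> (1 <= D)%R ->
    exists gamma eta beta : R,
      [/\ (2 <= gamma)%R, (0 < eta)%R, (1 < beta)%R &
          forall A : algorithm R, is_GR_BAL gamma eta beta A ->
            feasible_policy delta D A /\
            asymptotically_competitive delta D A (Gamma C delta D)].
Proof.
(* The 23 comes from the tuning. If [ln M < e - 1], then [y = e], and [ln (delta * D) + 2 * ln y] is
   below [2 * (e - 1) + 2 = 2 * e]. *)
exists (23 + 2 * expR 1) => delta D delta1 D1.
have e2 : 2 <= expR 1 :> R by apply: le_trans (expR_ge1Dx 1); lra.
have delta0 := lt_le_trans ltr01 delta1; have D0 := lt_le_trans ltr01 D1.
set M := Num.max delta D.
have M0 : 0 < M by rewrite lt_max delta0.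
have lnP : ln (delta * D) <= 2 * ln M.
  rewrite lnM ?qualifE //= mulr_natl mulr2n lerD // ler_ln ?qualifE //=.
    by rewrite le_max lexx.
  by rewrite le_max lexx orbT.
pose y := if expR 1 - 1 <= ln M then ln M else expR 1.
have y1 : 1 <= y by rewrite /y; case: ifP => h; lra.
have Py : ln (delta * D) <= 2 * y by rewrite /y; case: (leP (expR 1 - 1)) => h; lra.
have P1 : 1 <= delta * D by rewrite mulr_ege1.
have y20 : 0 < 2 * y ^+ 2 by rewrite mulr_gt0 // exprn_gt0 // (lt_le_trans ltr01).
exists (2 * y), (2 * y ^+ 2)^-1, (1 + 2 * y ^+ 2 * (delta * D)).
have beta1 : 1 < 1 + 2 * y ^+ 2 * (delta * D).
  by rewrite ltrDl mulr_gt0 // (lt_le_trans ltr01).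
split => [|||A]; [lra|by rewrite invr_gt0|by []|].
apply: GR_BAL_competitive => //; [lra|by rewrite invr_gt0| |].
  by rewrite addrAC subrr add0r mulKf ?gt_eqF.
apply: le_trans (GR_BAL_tuning P1 y1 Py) _.
rewrite /Gamma -/M /y; case: (leP (expR 1 - 1)) => h; last by rewrite expRK; lra.
lra.
Qed.
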